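(* Let $R$ be a commutative quasilocal ring with $1\neq 0$ and with maximal ideal $M$. Let $x\in M$ be a nonzero prime element of $R$ such that $M\neq xR$. Then $xM$ is a 1-absorbing primary ideal of $R$ that is not a primary ideal of $R$.
   Context: All rings are commutative with $1\neq 0$ (not necessarily integral domains). A ring is quasilocal if it has exactly one maximal ideal. A nonzero nonunit element $x$ of $R$ is called prime if whenever $x\mid x_1x_2$ for some $x_1,x_2\in R$, then $x\mid x_1$ or $x\mid x_2$. For an ideal $I$ of $R$, $\sqrt{I}=\{r\in R \mid r^{n}\in I \text{ for some integer } n\geq 1\}$. A proper ideal $I$ of $R$ is called a 1-absorbing primary ideal of $R$ if whenever $a,b,c\in R$ are nonunit elements with $abc\in I$, then $ab\in I$ or $c\in\sqrt{I}$. *)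

(* Defs.v *)
From mathcomp Require Import all_boot all_algebra.
From mathcomp Require Import boolp classical_sets.

Set Implicit Arguments.
Unset Strict Implicit.
Unset Printing Implicit Defensive.

Import GRing.Theory.
Local Open Scope classical_set_scope.
Local Open Scope ring_scope.

Section CommutativeRings.
Variable R : comNzRingType.
Implicit Types (a b c x y : R) (I J M : set R).

(* [GRing.unit] is not available on a [comNzRingType]; invertibility is stated
   directly so that no inverse operation is assumed on [R]. *)
Definition is_unit a : Prop := exists b, a * b = 1.

Definition divides a b : Prop := exists c, b = a * c.

Definition prime_elt x : Prop :=
  [/\ x != 0, ~ is_unit x
    & forall x1 x2, divides x (x1 * x2) -> divides x x1 \/ divides x x2].

(* [idealr_closed] requires that 1 is not in the set, so it characterizes the
   proper ideals. *)
Definition proper_ideal_set I : Prop := idealr_closed (mem I).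

Definition maximal_ideal M : Prop :=
  proper_ideal_set M /\
  forall J, proper_ideal_set J -> M `<=` J -> J = M.

Definition radical I : set R := [set r | exists2 n, (1 <= n)%N & I (r ^+ n)].

Definition primary_ideal I : Prop :=
  proper_ideal_set I /\ forall a b, I (a * b) -> I a \/ radical I b.

Definition one_absorbing_primary_ideal I : Prop :=
  proper_ideal_set I /\
  forall a b c, ~ is_unit a -> ~ is_unit b -> ~ is_unit c ->
    I (a * b * c) -> I (a * b) \/ radical I c.

Definition principal x : set R := range (fun r => x * r).

Definition scale_ideal x I : set R := [set x * m | m in I].

End CommutativeRings.

Definition quasilocal (R : comNzRingType) : Prop :=
  exists! M : set R, maximal_ideal M.

(* Main.v *)
Require Import Defs.
From mathcomp Require Import all_boot all_algebra.
From mathcomp Require Import boolp classical_sets.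

(* Zorn's lemma puts every nonunit in the maximal ideal M of a quasilocal ring.
   If x | abc with a, b, c in M, then either x divides one of a and b, and the
   other factor witnesses ab in xM, or c = xr and c^2 = x(x r^2) lies in xM.
   For y in M outside xR the product xy lies in xM; but no power of y is divisible
   by x, and x = xm with m in M would force x = 0 since 1 - m is a unit. *)

Import GRing.Theory.
Local Open Scope classical_set_scope.
Local Open Scope ring_scope.

Lemma proper_ideal_setP (R : comNzRingType) (I : set R) :
  proper_ideal_set I <->
  [/\ I 0, ~ I 1 & forall r u v, I u -> I v -> I (r * u + v)].
Proof.
split=> [[I0 I1 Ilin]|[I0 I1 Ilin]].
  split; first exact/set_mem.
    by move=> /mem_set; apply/negP.
  by move=> r u v Iu Iv; apply/set_mem/Ilin; exact/mem_set.
split; first exact/mem_set.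
  by apply/negP => /set_mem.
by move=> r u v /set_mem Iu /set_mem Iv; apply/mem_set/Ilin.
Qed.

Lemma proper_ideal_mull {R : comNzRingType} {I : set R} (r : R) {u : R} :
  proper_ideal_set I -> I u -> I (r * u).
Proof.
by move=> /proper_ideal_setP[I0 _ Ilin] Iu; rewrite -[_ * _]addr0; exact: Ilin.
Qed.

Lemma principal_proper (R : comNzRingType) (a : R) :
  ~ is_unit a -> proper_ideal_set (principal a).
Proof.
move=> aNunit; apply/proper_ideal_setP; split.
- by exists 0; rewrite ?mulr0.
- by move=> [b _ ab1]; apply: aNunit; exists b.
- move=> r _ _ [s _ <-] [t _ <-]; exists (r * s + t) => //.
  by rewrite mulrDr mulrCA.
Qed.

Lemma scale_ideal_proper (R : comNzRingType) (x : R) (I : set R) :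
  ~ is_unit x -> proper_ideal_set I -> proper_ideal_set (scale_ideal x I).
Proof.
move=> xNunit /proper_ideal_setP[I0 _ Ilin]; apply/proper_ideal_setP; split.
- by exists 0; rewrite ?mulr0.
- by move=> [b _ xb1]; apply: xNunit; exists b.
- move=> r _ _ [s Is <-] [t It <-]; exists (r * s + t); first exact: Ilin.
  by rewrite mulrDr mulrCA.
Qed.

(** Zorn's lemma applies because closure under [r * u + v] and the absence of 1 pass to unions of
    chains. *)
Lemma proper_ideal_sub_maximal (R : comNzRingType) (I : set R) :
  proper_ideal_set I -> exists2 M, maximal_ideal M & I `<=` M.
Proof.
move=> /proper_ideal_setP[I0 I1 Ilin].
(* The empty set is admitted because [Zorn_bigcup] also takes the union of the
   empty chain. *)
pose P := [set J : set R | [/\ ~ J 1,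
  forall r u v, J u -> J v -> J (r * u + v) & J !=set0 -> I `<=` J]].
have PI : P I by split=> // _ u.
have [F FP Ftot|M [[M1 Mlin MI] Mmax]] := @Zorn_bigcup R P.
  split.
  - by move=> [J FJ J1]; have [] := FP _ FJ.
  - move=> r u v [J FJ Ju] [K FK Kv].
    (* Both [u] and [v] lie in the larger of the two chain members [J] and [K]. *)
    have [JK|KJ] := Ftot _ _ FJ FK.
      by exists K => //; have [_ + _] := FP _ FK; apply => //; exact: JK.
    by exists J => //; have [_ + _] := FP _ FJ; apply => //; exact: KJ.
  - move=> [u [J FJ Ju]] w Iw; exists J => //.
    by have [_ _] := FP _ FJ; apply => //; exists u.
have M_neq0 : M !=set0.
  (* An empty [M] would lie strictly below [I], which contains 0 and belongs to [P]. *)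
  apply: contrapT => M0; apply: (Mmax I) PI; split.
    by move=> u Mu; case: M0; exists u.
  by move=> MsubI; apply: M0; exists 0; exact: MsubI.
have IM := MI M_neq0.
exists M => //; split; first by apply/proper_ideal_setP; split=> //; exact: IM.
move=> J /proper_ideal_setP[J0 J1 Jlin] MJ; apply: contrapT => JM.
apply: (Mmax J).
  by split=> // JsubM; apply: JM; apply/seteqP; split.
by split=> // _; apply: subset_trans MJ.
Qed.

(** The principal ideal of [a] is proper, hence inside some maximal ideal, and uniqueness makes that
    ideal [M]. *)
Lemma quasilocal_nonunit {R : comNzRingType} {M : set R} {a : R} :
  quasilocal R -> maximal_ideal M -> ~ is_unit a -> M a.
Proof.
move=> [M0 [_ M0uniq]] Mmax /principal_proper/proper_ideal_sub_maximal[N Nmax aN].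
rewrite -(M0uniq _ Mmax) (M0uniq _ Nmax).
by apply: aN; exists 1; rewrite ?mulr1.
Qed.

(** Primality strips off one factor [y] at a time; at exponent 0, [x] would divide 1 and be a
    unit. *)
Lemma prime_elt_dividesX {R : comNzRingType} {x y : R} {n : nat} :
  prime_elt x -> divides x (y ^+ n) -> divides x y.
Proof.
move=> [_ xNunit xprime]; elim: n => [[b b1]|n IHn].
  by case: xNunit; exists b; rewrite -b1.
by rewrite exprS => /xprime[].
Qed.

Theorem theorem6 (R : comNzRingType) (M : set R) (x : R)
    (R_quasilocal : quasilocal R) (M_maximal : maximal_ideal M)
    (x_in_M : M x) (x_prime : prime_elt x)
    (M_neq_xR : M <> principal x) :
  one_absorbing_primary_ideal (scale_ideal x M) /\
  ~ primary_ideal (scale_ideal x M).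
Proof.
have [x_neq0 xNunit xdiv] := x_prime.
have [Mprop _] := M_maximal.
have nonunitM a : ~ is_unit a -> M a := quasilocal_nonunit R_quasilocal M_maximal.
split.
  split; first exact: scale_ideal_proper.
  move=> a b c /nonunitM Ma /nonunitM Mb _ [m _ abcE].
  have [/xdiv[[r ->]|[r ->]]|[r ->]] : divides x (a * b) \/ divides x c.
  - by apply: xdiv; exists m.
  - by left; exists (r * b); [exact: proper_ideal_mull | rewrite mulrA].
  - by left; exists (r * a); [exact: proper_ideal_mull | rewrite mulrA mulrC].
  (* The first power may fail, as [r] can be a unit in [c = x * r]; squaring leaves the cofactor
     [r ^+ 2 * x], in [M] because [x] is. *)
  - right; exists 2%N => //; exists (r ^+ 2 * x); first exact: proper_ideal_mull.
    by rewrite exprMn mulrCA -expr2 mulrC.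
move=> [_ xM_primary].
(* As [x] is in [M], [principal x] is contained in [M], so the two can differ only through some [y]
   of [M] outside it. *)
have [y My xNy] : exists2 y, M y & ~ divides x y.
  apply: contrapT => Mdiv; apply: M_neq_xR; apply/seteqP; split=> [y My|_ [r _ <-]].
    apply: contrapT => xNy; apply: Mdiv; exists y => // -[r yE].
    by apply: xNy; exists r.
  by rewrite mulrC; exact: proper_ideal_mull.
have [|[m Mm xmE]|[n _ [m _ xmE]]] := xM_primary x y; first by exists y.
(* Otherwise [1 - m] would lie in [M], and so would [1 = (1 - m) + m]. *)
- have [u mu1] : is_unit (1 - m).
    apply: contrapT => /nonunitM M1m; have /proper_ideal_setP[_ M1 Mlin] := Mprop.
    by apply: M1; rewrite -(subrK m 1) -[1 - m]mul1r; exact: Mlin.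
  move/eqP: x_neq0; apply.
  by rewrite -[x]mulr1 -mu1 mulrA mulrBr mulr1 xmE subrr mul0r.
- by apply: xNy; apply: (prime_elt_dividesX x_prime (n := n)); exists m.
Qed.
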